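(* Let $G$ be a finite metabelian group and let $H$ be an abelian normal subgroup of $G$ such that $G/H$ is abelian. Then $$\psi(H)+|H|\,(\psi(G/H)-1)\leq\psi(G)\leq\psi(H)+|H|^2\,(\psi(G/H)-1).$$
   Context: For a finite group $K$, $\psi(K)=\sum_{x\in K}o(x)$, where $o(x)$ denotes the order of the element $x$ in $K$. *)

(* Defs.v *)
From mathcomp Require Import all_boot all_fingroup all_solvable.

Set Implicit Arguments.
Unset Strict Implicit.
Unset Printing Implicit Defensive.

Definition psi (gT : finGroupType) (A : {set gT}) : nat :=
  \sum_(x in A) #[x]%g.
Arguments psi {gT} A%_g.

Definition metabelian (gT : finGroupType) (A : {set gT}) : bool :=
  abelian A^`(1)%g.
Arguments metabelian {gT} A%_g.

(* Hence psi K - 1 is never affected by the truncation of subtraction on nat. *)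
Lemma psi_gt0 (gT : finGroupType) (K : {group gT}) : 0 < psi K.
Proof. by rewrite /psi (bigD1 1%g) //= order1. Qed.

(* Main.v *)
Require Import Defs.
From mathcomp Require Import all_boot all_fingroup all_solvable.

(** Let [m] be the order of the coset [xH] of an element [x] of [G].  The
    order of [x] is a multiple of [m], as the quotient map is a morphism, and
    divides [m * #|H|], as [x ^+ m] lies in [H]; hence it lies between [m] and
    [m * #|H|] ([order_coset_bounds]).  The elements of [G] outside [H] are
    spread evenly over the nontrivial cosets, [#|H|] of them in each
    ([sum_coset_outside]), so summing these bounds over them gives [#|H|],
    respectively [#|H| ^ 2], times the sum of the orders of the nontrivial
    elements of [G / H], which is [psi (G / H) - 1].  The elements of [H]
    contribute [psi H] to [psi G]. *)

(** The upper bound comes from Lagrange's theorem in [H], applied to the power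
    of [x] whose exponent is the order of its coset. *)
Lemma order_coset_bounds (gT : finGroupType) (H : {group gT}) (x : gT) :
  x \in 'N(H)%g ->
  #[coset H x]%g <= #[x]%g <= #[coset H x]%g * #|H|.
Proof.
move=> Nx; apply/andP; split.
  by rewrite dvdn_leq ?order_gt0 // morph_order.
rewrite dvdn_leq ?muln_gt0 ?order_gt0 ?cardG_gt0 //.
rewrite order_dvdn expgM; apply/eqP/expg_cardG.
by apply: coset_idr; rewrite ?groupX // morphX // expg_order.
Qed.

(** The fibre of the quotient map over a nontrivial coset is that coset itself,
    which has [#|H|] elements and does not meet [H]. *)
Lemma sum_coset_outside (gT : finGroupType) (G H : {group gT})
    (F : coset_of H -> nat) :
  (H <| G)%g ->
  \sum_(x in G :\: H) F (coset H x)
    = #|H| * \sum_(c in (G / H)^#%g) F c.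
Proof.
case/andP=> sHG nHG.
rewrite (partition_big (coset H) (mem (G / H)^#%g)) /=; last first.
  move=> x /setDP[Gx notHx]; rewrite !inE mem_quotient // andbT.
  by apply: contra notHx => /eqP/coset_idr-> //; apply: (subsetP nHG).
rewrite big_distrr /=; apply: eq_bigr => c /setD1P[ntc /morphimP[y Ny Gy Dc]].
rewrite (eq_bigr (fun=> F c)) => [|x /andP[_ /eqP->]//].
rewrite sum_nat_const -(card_rcoset H y); congr (_ * _).
apply: eq_card => x; rewrite unfold_in /= in_setD; apply/idP/idP.
  case/andP=> /andP[_ Gx] /eqP Dx; have Nx := subsetP nHG x Gx.
  by apply/rcoset_kercosetP; rewrite // Dx.
move=> Hyx; have Gx: x \in G.
  by case/rcosetP: Hyx => h /(subsetP sHG) Gh ->; rewrite groupM.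
have Nx := subsetP nHG x Gx.
have Dx: coset H x = c by rewrite Dc; apply/rcoset_kercosetP.
rewrite Gx Dx eqxx !andbT; apply: contra ntc => Hx.
by rewrite -Dx coset_id.
Qed.

Lemma psi_sub1 (gT : finGroupType) (K : {group gT}) :
  psi K - 1 = \sum_(x in K^#%g) #[x]%g.
Proof. by rewrite /psi (big_setD1 1%g) //= order1 addKn. Qed.

Theorem corollary1p2 (gT : finGroupType) (G H : {group gT})
    (metabG : metabelian G) (nsHG : (H <| G)%g)
    (abelH : abelian H) (abelGH : abelian (G / H)%g) :
  psi H + #|H| * (psi (G / H)%g - 1) <= psi G
    <= psi H + #|H| ^ 2 * (psi (G / H)%g - 1).
Proof.
have [sHG nHG] := andP nsHG.
have ->: psi G = psi H + \sum_(x in G :\: H) #[x]%g.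
  by rewrite /psi (big_setID H) /= (setIidPr sHG).
have bounds x: x \in G :\: H ->
    #[coset H x]%g <= #[x]%g <= #[coset H x]%g * #|H|.
  by case/setDP=> Gx _; rewrite order_coset_bounds ?(subsetP nHG).
rewrite psi_sub1 !leq_add2l -mulnn -mulnA -sum_coset_outside // big_distrr /=.
by apply/andP; split; apply: leq_sum => x /bounds/andP[] //; rewrite mulnC.
Qed.
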